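(* There exist absolute constants $c_1>0$ and $c_2>0$ (and a threshold $N$) such that for every finite set $A \subset \mathbb{R}$ with $|A| \geq N$ and $|A+A| \leq |A|^{1+c_1}$, we have $|AAA| \geq |A|^{2+c_2}$.
   Context: For finite $A \subset \mathbb{R}$, $A+A := \{a+b : a,b \in A\}$ and $AAA := \{a_1a_2a_3 : a_1,a_2,a_3 \in A\}$. The phrase ''for all sufficiently large finite sets'' in the paper is expressed here by the threshold $N$ on $|A|$. *)

(* Defs.v *)
From mathcomp Require Import all_boot all_order all_algebra finmap.

Set Implicit Arguments.
Unset Strict Implicit.
Unset Printing Implicit Defensive.

Local Open Scope ring_scope.

Definition sumset (R : nzRingType) (A B : {fset R}) : {fset R} :=
  [fset (a + b)%R | a in A, b in B]%fset.

Definition prodset (R : nzRingType) (A B : {fset R}) : {fset R} :=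
  [fset (a * b)%R | a in A, b in B]%fset.

Definition prodset3 (R : nzRingType) (A B C : {fset R}) : {fset R} :=
  prodset (prodset A B) C.

Lemma prodset3P (R : nzRingType) (A B C : {fset R}) (x : R) :
  reflect (exists a b c, [/\ a \in A, b \in B, c \in C & x = a * b * c])
          (x \in prodset3 A B C).
Proof.
apply: (iffP idP).
  case/imfset2P => /= p + [c cC ->] => /imfset2P[/= a aA [b bB ->]].
  by exists a, b, c.
move=> [a [b [c [aA bB cC ->]]]].
by apply: in_imfset2 => //=; apply: in_imfset2.
Qed.

(* Main.v *)
Require Import Defs.
From mathcomp Require Import all_boot all_order all_algebra finmap.
From mathcomp Require Import zify ring lra.
From mathcomp Require Import reals exp.

Set Implicit Arguments.
Unset Strict Implicit.
Unset Printing Implicit Defensive.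

(** Suppose [|A + A|] is close to [|A|] and [|AAA|] is close to [|A|^2], and
    pass to a set [P] of positive elements of [A] (or of [- A]).
    Solymosi's consecutive-slopes argument gives [|PP| >= |P|^(2 - o(1))], so
    multiplying [PP] by [P] hardly enlarges it, and the Plünnecke-Ruzsa
    inequality, applied to logarithms, bounds the set of quotients
    [p1 p2 p3 p4 / (p5 p6 p7)] by about [|P|^2].
    On the other hand this set has about [|P|^3] elements, by the squeezing
    argument of Hanson, Roche-Newton and Rudnev: since [|P + P - P|] is small,
    some gap [d] between consecutive elements of [P] occurs at nearly [|P|]
    places [B], and some gap [e] of [B] at nearly [|B|] places [B']; then
    concavity of [ln] and monotonicity of its second differences make
    [ln a + (ln (b + e + d) - ln (b + e)) + (second difference of ln at c)]
    an injective function of the triples [a <= b <= c] in [B']. *)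

Import Order.TTheory GRing.Theory Num.Theory.
Local Open Scope fset_scope.

(** * Counting in finite sets *)

Lemma leq_card_inj (T U : choiceType) (A : {fset T}) (B : {fset U}) (f : T -> U) :
  {in A &, injective f} -> {in A, forall x, f x \in B} -> #|` A| <= #|` B|.
Proof.
move=> f_inj fAB; rewrite -(card_in_imfset imfset_key f_inj).
by apply/fsubset_leq_card/fsubsetP => _ /imfsetP[x /= xA ->]; exact: fAB.
Qed.

Lemma card_fset_sep (T : choiceType) (A : {fset T}) (P : pred T) :
  #|` [fset x in A | P x]| = \sum_(x <- A | P x) 1.
Proof. by rewrite card_fset_sum1 big_fset. Qed.

Lemma sum_card_fibers (T U : choiceType) (A : {fset T}) (h : T -> U) :
  #|` A| = \sum_(y <- [fset h x | x in A]) #|` [fset x in A | h x == y]|.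
Proof.
rewrite card_fset_sum1 (partition_big_imfset _ h) /=.
by apply: eq_bigr => y _; rewrite card_fset_sep.
Qed.

Lemma card_fsetM (T U : choiceType) (A : {fset T}) (B : {fset U}) :
  #|` A `*` B| = #|` A| * #|` B|.
Proof.
rewrite card_fset_sum1 big_imfset2 //=; last by move=> [? ?] [? ?] _ _ /= [-> ->].
rewrite (eq_bigr (fun=> #|` B|)) => [|i _]; last by rewrite card_fset_sum1.
by rewrite big_const_seq count_predT iter_addn_0 mulnC.
Qed.

Lemma leq_card_fibers (T U : choiceType) (A : {fset T}) (B : {fset U}) (h : T -> U) k :
    {in B, forall y, k <= #|` [fset x in A | h x == y]|} ->
  k * #|` B| <= #|` A|.
Proof.
have [->|k_gt0] := posnP k; first by rewrite mul0n.
move=> fibB.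
(* Since [k] is positive, every fiber over [B] is nonempty, so [B] lies in the image of [h]. *)
have subB : B `<=` [fset h x | x in A].
  apply/fsubsetP => y yB; have := leq_trans k_gt0 (fibB y yB).
  rewrite cardfs_gt0 => /fset0Pn[x]; rewrite !inE /= => /andP[xA /eqP <-].
  exact: in_imfset.
rewrite (sum_card_fibers _ h) mulnC card_fset_sum1 big_distrl /=.
rewrite [leqRHS](big_fsetID _ (mem B)) /= (_ : [fset x in _ | _] = B); last first.
  apply/fsetP => y; rewrite !inE /=; have [yB|_] := boolP (y \in B); last by rewrite andbF.
  by rewrite (fsubsetP subB).
rewrite (leq_trans _ (leq_addr _ _)) // big_seq [leqRHS]big_seq.
by apply: leq_sum => y yB; rewrite mul1n fibB.
Qed.

(** Pigeonhole: the largest fiber is at least as large as the average one. *)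
Lemma exists_large_fiber (T U : choiceType) (A : {fset T}) (h : T -> U) :
    A != fset0 ->
  exists2 y, y \in [fset h x | x in A]
    & #|` A| <= #|` [fset h x | x in A]| * #|` [fset x in A | h x == y]|.
Proof.
move=> /fset0Pn[x0 x0A].
pose F y := #|` [fset x in A | h x == y]|.
have [y0 y0A le_y0] : exists2 y, y \in [fset h x | x in A]
    & {in [fset h x | x in A], forall z, F z <= F y}.
  pose B := [fset h x | x in A].
  have hx0 : h x0 \in B by exact: in_imfset.
  case: (arg_maxnP (fun y : B => F (val y)) (isT : xpredT [` hx0])) => y _ maxy.
  by exists (val y) => [|z zB]; [exact: valP | exact: (maxy [` zB] isT)].
exists y0 => //; rewrite [leqLHS](sum_card_fibers _ h) [X in X * _]card_fset_sum1.
rewrite big_distrl /= big_seq [leqRHS]big_seq.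
by apply: leq_sum => y yA; rewrite mul1n le_y0.
Qed.

(** Built by adding, one at a time, an element of least [f]-value among those left. It serves to cut
    a set into blocks, ordered by gap length or by the elements themselves. *)
Lemma exists_lower_part (T : choiceType) d (U : orderType d) (f : T -> U)
    (A : {fset T}) k : k <= #|` A| ->
  exists2 B, B `<=` A & #|` B| = k /\
    {in B & A `\` B, forall x y, (f x <= f y)%O}.
Proof.
elim: k => [_|k IHk lt_kA].
  by exists fset0; rewrite ?fsub0set ?cardfs0 //; split.
have [B subBA [cardB leB]] := IHk (ltnW lt_kA).
have : A `\` B != fset0.
  by rewrite -cardfs_gt0 cardfsDS // cardB subn_gt0.
move=> /fset0Pn[x0 x0D].
case: (arg_minP (fun y : A `\` B => f (val y)) (isT : xpredT [` x0D])) => x _ minx.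
have := valP x; rewrite inE => /andP[xNB xA].
exists (val x |` B); first by rewrite fsubUset fsub1set xA.
split; first by rewrite cardfsU1 xNB cardB.
move=> y z; rewrite !inE negb_or => /orP[/eqP->|yB] /andP[/andP[zNx zNB] zA].
  have zD : z \in A `\` B by rewrite inE zNB.
  exact: (minx [` zD] isT).
by apply: leB; rewrite // inE zNB.
Qed.

(** * The Plünnecke-Ruzsa inequality *)

Section PlunneckeRuzsa.
Context {R : nzRingType}.
Implicit Types A B C X Z : {fset R}.
Local Open Scope ring_scope.

Definition nsumset (k : nat) A : {fset R} := iter k (fun C : {fset R} => sumset C A) [fset 0].

Definition diffset A B : {fset R} := [fset (a - b)%R | a in A, b in B].

Lemma sumsetP A B x :
  reflect (exists a b, [/\ a \in A, b \in B & x = a + b]) (x \in sumset A B).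
Proof.
apply: (iffP idP) => [/imfset2P[/= a aA [b bB ->]]|]; first by exists a, b.
by move=> [a [b [aA bB ->]]]; exact: in_imfset2.
Qed.

Lemma mem_sumset A B a b : a \in A -> b \in B -> a + b \in sumset A B.
Proof. by move=> aA bB; apply/sumsetP; exists a, b. Qed.

Lemma diffsetP A B x :
  reflect (exists a b, [/\ a \in A, b \in B & x = a - b]) (x \in diffset A B).
Proof.
apply: (iffP idP) => [/imfset2P[/= a aA [b bB ->]]|]; first by exists a, b.
by move=> [a [b [aA bB ->]]]; exact: in_imfset2.
Qed.

Lemma mem_diffset A B a b : a \in A -> b \in B -> a - b \in diffset A B.
Proof. by move=> aA bB; apply/diffsetP; exists a, b. Qed.

Lemma sumsetA A B C : sumset A (sumset B C) = sumset (sumset A B) C.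
Proof.
apply/fsetP => x; apply/sumsetP/sumsetP.
  move=> [a [_ [aA /sumsetP[b [c [bB cC ->]]] ->]]].
  by exists (a + b), c; rewrite mem_sumset // addrA.
move=> [_ [c [/sumsetP[a [b [aA bB ->]]] cC ->]]].
by exists a, (b + c); rewrite mem_sumset // addrA.
Qed.

Lemma sumsetC A B : sumset A B = sumset B A.
Proof.
by apply/fsetP => x; apply/sumsetP/sumsetP => -[a [b [aA bB ->]]];
  exists b, a; rewrite addrC.
Qed.

Lemma sumset0 A : sumset A [fset 0] = A.
Proof.
apply/fsetP => x; apply/sumsetP/idP => [[a [b [aA]]]|xA].
  by rewrite inE => /eqP -> ->; rewrite addr0.
by exists x, 0; rewrite addr0 inE.
Qed.

Lemma nsumset1 A : nsumset 1 A = A.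
Proof. by rewrite /nsumset /= sumsetC sumset0. Qed.

Lemma sumset1S A c : #|` sumset A [fset c]| = #|` A|.
Proof.
apply/eqP; rewrite eqn_leq; apply/andP; split.
  apply: (@leq_card_inj _ _ _ _ (fun x => x - c)) => [x y _ _ /addIr//|].
  by move=> y /sumsetP[a [b [aA]]]; rewrite inE => /eqP -> ->; rewrite addrK.
apply: (@leq_card_inj _ _ _ _ (fun x => x + c)) => [x y _ _ /addIr//|a aA].
by rewrite mem_sumset // inE.
Qed.

Lemma card_nsumset_gt0 k A : (0 < #|` A|)%N -> (0 < #|` nsumset k A|)%N.
Proof.
move=> A_gt0; elim: k => [|k]; first by rewrite cardfs1.
move: A_gt0; rewrite !cardfs_gt0 => /fset0Pn[a aA] /fset0Pn[b bA].
by apply/fset0Pn; exists (b + a); exact: mem_sumset.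
Qed.

(* A set minimising the growth ratio under [+ A] keeps that ratio after adding any third set. *)
Lemma petridis X A C :
    (forall Z, Z `<=` X -> #|` sumset X A| * #|` Z| <= #|` sumset Z A| * #|` X|)%N ->
  (#|` sumset (sumset X A) C| * #|` X| <= #|` sumset X A| * #|` sumset X C|)%N.
Proof.
move=> minX; move: C; apply: (@fset1U_rect _ (fun C => is_true
  (#|` sumset (sumset X A) C| * #|` X| <= #|` sumset X A| * #|` sumset X C|)%N))
  => [|c C cNC IHC].
  rewrite (_ : sumset _ fset0 = fset0) ?cardfs0 //.
  by apply/fsetP => x; rewrite inE; apply/sumsetP => -[a [b [_]]]; rewrite inE.
set XA := sumset X A.
(* [Z] collects the [x] whose whole translate [x + c + A] is already covered by [XA + C]. *)
pose Z := [fset x in X | sumset [fset x + c] A `<=` sumset XA C].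
have subZX : Z `<=` X by apply/fsubsetP => x; rewrite !inE /= => /andP[].
have le_num : (#|` sumset XA (c |` C)| + #|` sumset Z A|
               <= #|` sumset XA C| + #|` XA|)%N.
  pose ZA := sumset Z A.
  have subZA : ZA `<=` XA.
    apply/fsubsetP => _ /sumsetP[z [a [zZ aA ->]]].
    by rewrite mem_sumset // (fsubsetP subZX).
  have le1 : (#|` sumset XA (c |` C) | <=
     #|` sumset XA C `|` sumset (XA `\` ZA) [fset c]|)%N.
    apply/fsubset_leq_card/fsubsetP => _ /sumsetP[y [d [yXA + ->]]].
    rewrite !inE => /orP[/eqP ->|dC]; last by rewrite mem_sumset.
    have [/sumsetP[z [a [zZ aA ->]]]|yNZ] := boolP (y \in ZA).
      have := zZ; rewrite !inE /= => /andP[zX /fsubsetP sub].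
      apply/orP; left; apply: sub; rewrite addrAC mem_sumset // inE //.
    by apply/orP; right; rewrite mem_sumset // !inE ?yNZ.
  have := leq_trans le1 (leq_card_fsetU _ _).
  rewrite sumset1S cardfsDS // => le2.
  rewrite (leq_trans (leq_add le2 (leqnn _))) // -addnA subnK //.
  exact: fsubset_leq_card.
(* If [x + c] already lies in [X + C], then [x + c + A] lies in [XA + C]; so the overlap of [X + C]
   and [X + c] has at most [|Z|] elements. *)
have le_den : (#|` sumset X C| + #|` X| <= #|` sumset X (c |` C)| + #|` Z|)%N.
  have -> : sumset X (c |` C) = sumset X C `|` sumset X [fset c].
    apply/fsetP => y; apply/sumsetP/fsetUP.
      move=> [x [d [xX]]]; rewrite !inE => /orP[/eqP ->|dC] ->; [right|left];
        by rewrite mem_sumset ?inE.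
    by move=> [] /sumsetP[x [d [xX dC ->]]]; exists x, d; rewrite !inE in dC *;
      rewrite dC ?orbT.
  rewrite -[X in (_ + X <= _)%N](sumset1S X c) -cardfsUI leq_add2l.
  apply: (@leq_card_inj _ _ _ _ (fun x => x - c)) => [x y _ _ /addIr//|].
  move=> y; rewrite inE => /andP[/sumsetP[x [d [xX dC ->]]]].
  move=> /sumsetP[x' [c' [x'X]]]; rewrite inE => /eqP -> e.
  rewrite e addrK !inE /= x'X; apply/fsubsetP => w /sumsetP[u [a [+ aA ->]]].
  rewrite inE => /eqP ->; rewrite -e addrAC mem_sumset //.
  exact: mem_sumset.
have := minX Z subZX; rewrite -/XA => minZ.
move: le_num le_den minZ IHC; rewrite -/XA.
move: #|` _| #|` _| #|` _| #|` _| #|` _| #|` _| #|` _| => a b c' d e f g; nia.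
Qed.

Lemma exists_min_growth A B : (0 < #|` B|)%N ->
  exists2 X, X `<=` B /\ (0 < #|` X|)%N &
    (#|` sumset X A| * #|` B| <= #|` sumset B A| * #|` X|)%N /\
    (forall Z, Z `<=` X -> #|` sumset X A| * #|` Z| <= #|` sumset Z A| * #|` X|)%N.
Proof.
move=> B_gt0.
have BP : B \in fpowerset B by rewrite fpowersetE.
pose F (X : fpowerset B) : rat := #|` sumset (val X) A|%:R / #|` val X|%:R.
case: (@arg_minP _ _ _ [` BP] (fun X : fpowerset B => (0 < #|` val X|)%N) F B_gt0) => X X_gt0 minX.
have minX' Z : Z `<=` B -> (#|` sumset (val X) A| * #|` Z| <= #|` sumset Z A| * #|` val X|)%N.
  move=> ZB; have [->|Z_gt0] := posnP #|` Z|; first by rewrite muln0.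
  have ZP : Z \in fpowerset B by rewrite fpowersetE.
  have := minX [` ZP] Z_gt0; rewrite /F ler_pdivrMr ?ltr0n // mulrAC.
  by rewrite ler_pdivlMr ?ltr0n // -!natrM ler_nat.
exists (val X); first by rewrite -fpowersetE (valP X).
split=> [|Z ZX]; first exact: minX'.
by apply: minX'; rewrite (fsubset_trans ZX) // -fpowersetE (valP X).
Qed.

(** Fix a representation [d = a - b] of each difference. The pair [(d, x)] can be read off
    [(x + a, x + b)]: the difference of the coordinates gives [d], hence [a], and then [x]. *)
Lemma ruzsa_triangle X A B :
  (#|` diffset A B| * #|` X| <= #|` sumset X A| * #|` sumset X B|)%N.
Proof.
(* The default [(0, 0)] is reached only for [d] outside the difference set. *)
pose rep d := head (0, 0) [seq p <- A `*` B | p.1 - p.2 == d].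
have repP d : d \in diffset A B ->
    [/\ (rep d).1 \in A, (rep d).2 \in B & (rep d).1 - (rep d).2 = d].
  move=> /diffsetP[a [b [aA bB dE]]].
  have : rep d \in [seq p <- A `*` B | p.1 - p.2 == d].
    have : (a, b) \in [seq p <- A `*` B | p.1 - p.2 == d].
      by rewrite mem_filter /= -dE eqxx inE /= aA.
    by rewrite /rep; case: filter => //= p s _; rewrite mem_head.
  by rewrite mem_filter inE => /andP[/eqP -> /andP[-> ->]].
rewrite -!card_fsetM.
apply: (@leq_card_inj _ _ _ _ (fun u => (u.2 + (rep u.1).1, u.2 + (rep u.1).2))).
  move=> [d x] [d' x']; rewrite !inE /= => /andP[dD _] /andP[d'D _] [e1 e2].
  have ed : d = d'.
    have [[_ _ dE] [_ _ d'E]] := (repP d dD, repP d' d'D).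
    have sub_add (y u v : R) : (y + u) - (y + v) = u - v.
      by rewrite opprD addrACA subrr add0r.
    by rewrite -dE -d'E -(sub_add x) e1 e2 sub_add.
  by move: e1; rewrite ed => /addIr ->.
by move=> [d x]; rewrite !inE /= => /andP[/repP[aA bB _] xX]; rewrite !mem_sumset.
Qed.

Lemma card_add_nsumset X A k :
    (forall Z, Z `<=` X -> #|` sumset X A| * #|` Z| <= #|` sumset Z A| * #|` X|)%N ->
  (#|` sumset X (nsumset k A)| * #|` X| ^ k <= #|` sumset X A| ^ k * #|` X|)%N.
Proof.
move=> minX; elim: k => [|k IHk]; first by rewrite sumset0 mulnC.
have leP := petridis (nsumset k A) minX.
rewrite /= (sumsetC (nsumset k A)) sumsetA.
rewrite expnS mulnA (leq_trans (leq_mul leP (leqnn _))) //.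
by rewrite -mulnA (leq_trans (leq_mul (leqnn _) IHk)) // expnS mulnA.
Qed.

(** Take a subset [X] of [B] of least growth under [A]. The triangle inequality based at [X] reduces
    the claim to the growth of [X] under [k] and [l] copies of [A], where each copy costs one growth
    ratio; that ratio is at most the one of [B]. *)
Lemma plunnecke_ruzsa A B k l : (0 < #|` B|)%N ->
  (#|` diffset (nsumset k A) (nsumset l A)| * #|` B| ^ (k + l)
   <= #|` sumset B A| ^ (k + l) * #|` B|)%N.
Proof.
move=> B_gt0; have [X [XB X_gt0] [leX minX]] := exists_min_growth A B_gt0.
move/fsubset_leq_card: XB => XB.
have leT := ruzsa_triangle X (nsumset k A) (nsumset l A).
have lek := card_add_nsumset k minX; have lel := card_add_nsumset l minX.
move: leX XB X_gt0 leT lek lel {minX}.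
set D := #|` diffset _ _|; set P := #|` sumset X (nsumset k A)|.
set Q := #|` sumset X (nsumset l A)|; set s := #|` sumset X A|.
set t := #|` sumset B A|; move: #|` X| #|` B| => x b leX xb x_gt0 leT lek lel.
have leD : (D * x ^ (k + l) <= s ^ (k + l) * x)%N.
  rewrite -(leq_pmul2r x_gt0) mulnAC (leq_trans (leq_mul leT (leqnn _))) //.
  by rewrite !expnD mulnACA -[leqRHS]mulnA [leqRHS]mulnACA leq_mul.
rewrite -(@leq_pmul2r (x ^ (k + l))) ?expn_gt0 ?x_gt0 // mulnAC.
rewrite (leq_trans (leq_mul leD (leqnn _))) // mulnAC -expnMn.
have le_exp : ((s * b) ^ (k + l) <= (t * x) ^ (k + l))%N.
  by case: (k + l)%N => // e; rewrite leq_exp2r.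
rewrite (leq_trans (leq_mul le_exp (leqnn _))) //.
by rewrite expnMn -mulnA [leqRHS]mulnAC -mulnA leq_mul2l leq_mul2l xb !orbT.
Qed.
End PlunneckeRuzsa.

(** * Popular gaps *)

Section Successor.
Context {R : realDomainType}.
Implicit Types A B : {fset R}.
Local Open Scope ring_scope.

(* Equal to [x] when no element of [A] exceeds [x]. *)
Definition next_in A (x : R) : R := head x [seq y <- sort <=%R A | x < y].

Lemma next_inP A x y : y \in A -> x < y ->
  [/\ next_in A x \in A, x < next_in A x & next_in A x <= y].
Proof.
move=> yA xy; rewrite /next_in.
have : sorted <=%R [seq y <- sort <=%R A | x < y].
  by apply: sorted_filter; [exact: le_trans | exact: sort_le_sorted].
have memE z : (z \in [seq y <- sort <=%R A | x < y]) = (x < z) && (z \in A).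
  by rewrite mem_filter mem_sort.
case: [seq y <- _ | _] memE => [/(_ y)|w s memE]; first by rewrite xy yA.
rewrite /= (path_sortedE le_trans) => /andP[/allP le_w _].
have := memE w; rewrite mem_head => /esym/andP[xw wA].
split=> //; have := memE y; rewrite xy yA inE => /orP[/eqP->//|].
exact: le_w.
Qed.

Lemma next_in_mem A x : x \in A -> next_in A x \in A.
Proof.
move=> xA; rewrite /next_in; case E: [seq _ <- _ | _] => [//|w s].
have : w \in [seq y <- sort <=%R A | x < y] by rewrite E mem_head.
by rewrite mem_filter mem_sort => /andP[].
Qed.

(** Only the maximum of [A] lacks a successor: of two elements without one, the smaller would be
    followed by the larger. *)
Lemma card_lt_next_in A :
  (#|` A| <= #|` [fset x in A | (x < next_in A x)%R]|.+1)%N.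
Proof.
set A' := [fset x in A | _].
rewrite -(cardfsID A' A) -addn1 leq_add //.
  by rewrite fsubset_leq_card // fsubsetIr.
rewrite -(cardfs1 tt).
apply: (@leq_card_inj _ _ _ _ (fun=> tt)) => [x y|x _]; last by rewrite inE.
rewrite !in_fsetD !inE /= => /andP[Nx xA] /andP[Ny yA] _.
rewrite xA /= in Nx; rewrite yA /= in Ny.
case: (ltgtP x y) => // lt.
  by case/negP: Nx; have [] := next_inP yA lt.
by case/negP: Ny; have [] := next_inP xA lt.
Qed.

(* With [A1] the half of [A] carrying the shorter gaps and [A2] the other half, sums of an
   element of [A2] and a gap of [A1] are distinct and lie in [A + A - A]; hence there are
   few gap lengths on [A1]. *)
Lemma exists_popular_gap A :
  exists2 d : R, 0 < d & exists2 B, B `<=` A &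
    [/\ {in B, forall b : R, b + d \in A},
        {in B & A, forall b a : R, b < a -> b + d <= a}
      & (#|` A| ^ 2 <= 16 * #|` diffset (sumset A A) A| * #|` B|.+1)%N].
Proof.
set W := #|` diffset _ _|.
have W_gt0 : (0 < #|` A|)%N -> (0 < W)%N.
  rewrite !cardfs_gt0 => /fset0Pn[a aA]; apply/fset0Pn.
  by exists (a + a - a); rewrite mem_diffset ?mem_sumset.
pose A' := [fset x in A | x < next_in A x].
have subA' : A' `<=` A by apply/fsubsetP => x; rewrite !inE => /andP[].
pose gap x := next_in A x - x.
have gap_gt0 x : x \in A' -> 0 < gap x.
  by rewrite !inE /= => /andP[_]; rewrite subr_gt0.
have gapA x : x \in A' -> x + gap x \in A.
  by move=> xA'; rewrite /gap addrC subrK next_in_mem // (fsubsetP subA').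
have gapP : {in A' & A, forall x a : R, x < a -> x + gap x <= a}.
  by move=> x a xA aA xa; rewrite /gap addrC subrK; have [] := next_inP aA xa.
(* For at most two elements the empty [B] works: the [.+1] leaves [16 * W] on the right, and [W] is
   positive when [A] is nonempty. *)
have [le_A2|lt2A] := leqP #|` A| 2.
  exists 1 => //; exists fset0; rewrite ?fsub0set //; split=> //.
  rewrite cardfs0 muln1; case: posnP W_gt0 => [->//|_ /(_ isT)]; nia.
have cardA' := card_lt_next_in A; rewrite -/A' in cardA'.
have le_k : (#|` A'|./2 <= #|` A'|)%N by lia.
have [A1 subA1 [cardA1 gapA1]] := exists_lower_part gap le_k.
pose A2 := A' `\` A1; pose D := [fset gap x | x in A1].
have cardA2 : #|` A2| = (#|` A'| - #|` A'|./2)%N by rewrite cardfsDS // cardA1.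
have A1_neq0 : A1 != fset0 by rewrite -cardfs_gt0 cardA1; lia.
have [d dD cardB] := exists_large_fiber gap A1_neq0; rewrite -/D in dD cardB.
have leW : (#|` A2| * #|` D| <= W)%N.
  rewrite -card_fsetM; apply: (@leq_card_inj _ _ _ _ (fun u => u.1 + u.2)) => /=.
    (* The gap after [a] is at least [gap x], so [a + gap x] does not pass the successor of [a],
       hence stays below [a' + gap x']. *)
    have ltP a a' x x' : a \in A2 -> a' \in A2 -> x \in A1 -> x' \in A1 ->
        a < a' -> a + gap x < a' + gap x'.
      rewrite !in_fsetD => /andP[aN aA'] /andP[a'N a'A'] xA1 x'A1 aa'.
      have a'A := fsubsetP subA' _ a'A'.
      have xA' := fsubsetP subA1 _ xA1; have x'A' := fsubsetP subA1 _ x'A1.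
      rewrite (@le_lt_trans _ _ a') ?ltrDl ?gap_gt0 //.
      by rewrite (le_trans _ (gapP _ _ aA' a'A aa')) // lerD2l gapA1 // inE aN.
    move=> [a e] [a' e'] /=; rewrite !in_fsetM /=.
    move=> /andP[aA2 /imfsetP[/= x xA1 ->]] /andP[a'A2 /imfsetP[/= x' x'A1 ->]] eqs.
    case: (ltgtP a a') => [lt|lt|aa'].
    - by have := ltP _ _ x x' aA2 a'A2 xA1 x'A1 lt; rewrite eqs ltxx.
    - by have := ltP _ _ x' x a'A2 aA2 x'A1 xA1 lt; rewrite eqs ltxx.
    by move: eqs; rewrite aa' => /addrI ->.
  move=> [a e]; rewrite in_fsetM /= in_fsetD => /andP[/andP[_ aA'] /imfsetP[/= x xA1 ->]].
  have xA' := fsubsetP subA1 _ xA1.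
  rewrite addrA mem_diffset ?mem_sumset // ?next_in_mem //;
  by rewrite (fsubsetP subA').
have d_gt0 : 0 < d.
  by case/imfsetP: dD => /= x xA1 ->; rewrite gap_gt0 // (fsubsetP subA1).
exists d => //; exists [fset x in A1 | gap x == d].
  apply/fsubsetP => x; rewrite !inE /= => /andP[xA1 _].
  by rewrite (fsubsetP subA') // (fsubsetP subA1).
split=> [x|x a|].
- rewrite !inE /= => /andP[xA1 /eqP <-]; apply: gapA; exact: (fsubsetP subA1).
- rewrite !inE /= => /andP[xA1 /eqP <-] aA; apply: gapP => //; exact: (fsubsetP subA1).
move: cardB leW; rewrite cardA1 cardA2.
move: #|` [fset _ in A1 | _]| #|` D| W #|` A'| #|` A| lt2A cardA' {W_gt0} => b e w n' n.
move=> lt2n len cardB leW.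
have ->: (n ^ 2 = n * n)%N by [].
have le_p : (n'./2 * n'./2 <= w * b)%N.
  apply: (@leq_trans ((n' - n'./2) * (e * b))); first by apply: leq_mul => //; lia.
  by rewrite mulnA leq_mul.
(* From [n - 1 <= n'] and [n > 2]; squaring this gives the constant 16. *)
have le4 : (n <= 4 * n'./2)%N by lia.
have := leq_mul le4 le4; nia.
Qed.
End Successor.

(** * Squeezing *)

Section Squeezing.
Context {R : realType}.
Implicit Types (P B : {fset R}) (d e x y : R).
Local Open Scope ring_scope.

Definition ln_incr d x : R := ln (x + d) - ln x.

(** A mixed second difference of [ln] with its sign reversed, which makes it positive. Its
    exponential is [1 + d e / (x (x + e + d))]. *)
Definition ln_incr2 d e x : R := ln_incr d x - ln_incr d (x + e).

Lemma ln_incr_gt0 d x : 0 < d -> 0 < x -> 0 < ln_incr d x.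
Proof. by move=> d0 x0; rewrite subr_gt0 ltr_ln ?posrE ?addr_gt0 // ltrDl. Qed.

Lemma ln_incr_anti d x y : 0 < d -> 0 < x -> x < y -> ln_incr d y < ln_incr d x.
Proof.
move=> d0 x0 xy; have y0 := lt_trans x0 xy.
have [xd yd] : 0 < x + d /\ 0 < y + d by rewrite !addr_gt0.
have : ln ((y + d) * x) < ln ((x + d) * y).
  by rewrite ltr_ln ?posrE ?mulr_gt0 //; nra.
by rewrite !lnM ?posrE // /ln_incr; lra.
Qed.

Lemma ln_incr2_gt0 d e x : 0 < d -> 0 < e -> 0 < x -> 0 < ln_incr2 d e x.
Proof. by move=> d0 e0 x0; rewrite subr_gt0 ln_incr_anti // ltrDl. Qed.

Lemma ln_incr2_anti d e x y : 0 < d -> 0 < e -> 0 < x -> x < y ->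
  ln_incr2 d e y < ln_incr2 d e x.
Proof.
move=> d0 e0 x0 xy; have y0 := lt_trans x0 xy.
have pos (z w : R) : 0 < z -> 0 < w -> 0 < z + w by exact: addr_gt0.
have : ln ((y + d) * (y + e) * (x * (x + e + d))) <
       ln ((x + d) * (x + e) * (y * (y + e + d))).
  rewrite ltr_ln ?posrE ?mulr_gt0 ?pos // -subr_gt0.
  rewrite (_ : _ - _ = d * e * ((y - x) * (y + x + d + e))); last by ring.
  by rewrite !mulr_gt0 ?subr_gt0 ?pos.
rewrite !lnM ?posrE ?mulr_gt0 ?pos // /ln_incr2 /ln_incr; lra.
Qed.

(* For [a <= b <= c] in [B], concavity of [ln] and convexity of its increments place
   [ln a + ln_incr d (b + e) + ln_incr2 d e c] in the interval [(ln a, ln (a + d)]], and inside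
   it in a translate of [(ln_incr d (b + e), ln_incr d b]]; by the separation hypotheses these
   are disjoint for distinct [a], respectively distinct [b], so the triple can be recovered. *)
Lemma ln_squeeze P B d e : 0 < d -> 0 < e -> (0 < #|` P|)%N ->
    {in P, forall x, 0 < x} ->
    {in B, forall b, [/\ b \in P, b + d \in P, b + e \in P & b + e + d \in P]} ->
    {in B &, forall a b : R, a < b -> a + d <= b} ->
    {in B &, forall a b : R, a < b -> a + e <= b} ->
  (#|` B|.+1 ^ 3 <= 216 * #|` diffset (nsumset 4 [fset ln x | x in P])
                                      (nsumset 3 [fset ln x | x in P])|)%N.
Proof.
move=> d0 e0 P_gt0 Ppos BP sepd sepe; set L := [fset ln x | x in P]; set Q := #|` diffset _ _|.
have lnL x : x \in P -> ln x \in L by move=> xP; exact: in_imfset.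
have Q_gt0 : (0 < Q)%N.
  have L_gt0 : (0 < #|` L|)%N.
    rewrite cardfs_gt0; move: P_gt0; rewrite cardfs_gt0 => /fset0Pn[x xP].
    by apply/fset0Pn; exists (ln x); exact: lnL.
  have := card_nsumset_gt0 4 L_gt0; have := card_nsumset_gt0 3 L_gt0.
  rewrite !cardfs_gt0 => /fset0Pn[x x3] /fset0Pn[y y4].
  by apply/fset0Pn; exists (y - x); rewrite mem_diffset.
(* Three consecutive blocks of about a third of [B] each supply the ordered triples [a <= b <= c] as
   a full Cartesian product. *)
have [B1 sub1 [card1 le1]] := exists_lower_part (@id R) (leq_div #|` B| 3).
have cardC : #|` B `\` B1| = (#|` B| - #|` B| %/ 3)%N by rewrite cardfsDS // card1.
have le_kC : (#|` B| %/ 3 <= #|` B `\` B1|)%N by rewrite cardC; lia.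
have [B2 sub2 [card2 le2]] := exists_lower_part (@id R) le_kC.
have card3 : #|` (B `\` B1) `\` B2| = (#|` B| - #|` B| %/ 3 - #|` B| %/ 3)%N.
  by rewrite cardfsDS // cardC card2.
move: le2 card3; set B3 := _ `\` B2 => le2 card3.
have leQ : (#|` B1| * #|` B2| * #|` B3| <= Q)%N; last first.
  move: leQ; rewrite card1 card2 card3; move: #|` B| Q Q_gt0 => m q q_gt0.
  have le_m3 : (m %/ 3 <= m - m %/ 3 - m %/ 3)%N by lia.
  move=> /(leq_trans (leq_mul (leqnn _) le_m3)) {le_m3}.
  (* Below 6 the bound follows from [Q >= 1] alone; from 6 on, [m + 1] is at most 6 times
     [m %/ 3]. *)
  case: (ltnP m 6) => [lt_m _|ge_m le_q].
    by rewrite (@leq_trans (6 ^ 3)) ?leq_exp2r // leq_pmulr.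
  apply: (@leq_trans ((6 * (m %/ 3)) ^ 3)); first by rewrite leq_exp2r //; lia.
  by rewrite expnMn leq_mul2l /= !expnS expn0 muln1 mulnA.
pose F (u : R * R * R) :=
  ln u.1.1 + ln_incr d (u.1.2 + e) + ln_incr2 d e u.2.
rewrite -!card_fsetM.
have BP0 b : b \in B -> 0 < b by move=> /BP[/Ppos].
have tripP u : u \in B1 `*` B2 `*` B3 ->
    [/\ u.1.1 \in B, u.1.2 \in B, u.2 \in B, u.1.1 <= u.1.2 & u.1.2 <= u.2].
  case: u => [[a b] c]; rewrite !in_fsetM /= => /andP[/andP[aB bB] cB].
  have bC := fsubsetP sub2 _ bB; have cC : c \in B `\` B1 by case/fsetDP: cB.
  split; [exact: (fsubsetP sub1)| | | exact: le1 | exact: le2].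
    by case/fsetDP: bC.
  by case/fsetDP: cC.
have innerP a b c : [/\ a \in B, b \in B, c \in B, a <= b & b <= c] ->
    ln_incr d (b + e) < F (a, b, c) - ln a <= ln_incr d b.
  move=> [aB bB cB ab bc]; have := ln_incr2_gt0 d0 e0 (BP0 _ cB).
  have : ln_incr2 d e c <= ln_incr2 d e b.
    by move: bc; rewrite le_eqVlt => /predU1P[->//|/ln_incr2_anti/ltW]; apply=> //; exact: BP0.
  by rewrite /F /= {2}/ln_incr2; lra.
have outerP a b c : [/\ a \in B, b \in B, c \in B, a <= b & b <= c] ->
    ln a < F (a, b, c) <= ln (a + d).
  move=> abc; have := innerP _ _ _ abc; case: abc => [aB bB cB ab bc].
  have := ln_incr_gt0 d0 (addr_gt0 (BP0 _ bB) e0).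
  have : ln_incr d b <= ln_incr d a.
    by move: ab; rewrite le_eqVlt => /predU1P[->//|/ln_incr_anti/ltW]; apply=> //; exact: BP0.
  by rewrite {2}/ln_incr; lra.
apply: (@leq_card_inj _ _ _ _ F).
  move=> [[a b] c] [[a' b'] c'] /tripP/= T /tripP/= T' eqF.
  have ltA x y z x' y' z' : [/\ x \in B, y \in B, z \in B, x <= y & y <= z] ->
      [/\ x' \in B, y' \in B, z' \in B, x' <= y' & y' <= z'] ->
      x < x' -> F (x, y, z) < F (x', y', z').
    move=> t t'; have := outerP _ _ _ t; have := outerP _ _ _ t'.
    case: t t' => [xB yB zB _ _] [x'B y'B z'B _ _] /andP[l _] /andP[_ r] /sepd le_x.
    have le_xx' := le_x xB x'B.
    have : ln (x + d) <= ln x' by rewrite ler_ln ?posrE ?addr_gt0 //; exact: BP0.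
    lra.
  have eq_a : a = a'.
    case: (ltgtP a a') => // lt.
      by have := ltA _ _ _ _ _ _ T T' lt; rewrite eqF ltxx.
    by have := ltA _ _ _ _ _ _ T' T lt; rewrite eqF ltxx.
  move: eqF T T'; rewrite -{}eq_a => eqF T T'.
  have ltB x y z y' z' : [/\ x \in B, y \in B, z \in B, x <= y & y <= z] ->
      [/\ x \in B, y' \in B, z' \in B, x <= y' & y' <= z'] ->
      y < y' -> F (x, y', z') < F (x, y, z).
    move=> t t'; have := innerP _ _ _ t; have := innerP _ _ _ t'.
    case: t t' => [xB yB zB _ _] [_ y'B z'B _ _] /andP[_ l] /andP[r _] /sepe le_y.
    have : ln_incr d y' <= ln_incr d (y + e).
      have := le_y yB y'B; rewrite le_eqVlt => /predU1P[->//|/ln_incr_anti/ltW]; apply=> //.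
      by rewrite addr_gt0 //; exact: BP0.
    lra.
  have eq_b : b = b'.
    case: (ltgtP b b') => // lt.
      by have := ltB _ _ _ _ _ T T' lt; rewrite eqF ltxx.
    by have := ltB _ _ _ _ _ T' T lt; rewrite eqF ltxx.
  move: eqF T T'; rewrite -{}eq_b /F /= => /addrI eqF [_ _ cB _ _] [_ _ c'B _ _].
  congr (_, _, _); case: (ltgtP c c') => // lt.
    by have := ln_incr2_anti d0 e0 (BP0 _ cB) lt; rewrite eqF ltxx.
  by have := ln_incr2_anti d0 e0 (BP0 _ c'B) lt; rewrite eqF ltxx.
move=> [[a b] c] /tripP/= [/BP[aP _ _ _] /BP[_ _ beP bedP] /BP[cP cdP ceP cedP] _ _].
(* Expanded, [F] has four logarithms with sign plus and three with sign minus, all of elements of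
   [P]; hence the indices 4 and 3. *)
rewrite (_ : F _ = (ln a + ln (b + e + d) + ln (c + d) + ln (c + e))
                 - (ln (b + e) + ln c + ln (c + e + d))).
  by apply: mem_diffset; rewrite !mem_sumset ?lnL // sumsetC sumset0 lnL.
by rewrite /F /ln_incr2 /ln_incr /=; ring.
Qed.
End Squeezing.

(** * Solymosi's bound on the multiplicative energy *)

Lemma sum_sqr_le (T : Type) (s : seq T) (f : T -> nat) :
  (\sum_(i <- s) f i) ^ 2 <= size s * \sum_(i <- s) f i ^ 2.
Proof.
elim: s => [|x s IHs]; first by rewrite !big_nil.
rewrite !big_cons /= sqrnD.
have : 2 * (f x * \sum_(i <- s) f i) <= size s * f x ^ 2 + \sum_(i <- s) f i ^ 2.
  elim: s {IHs} => [|y s IHs]; first by rewrite !big_nil muln0.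
  rewrite !big_cons /= !mulnDr (mulSn (size s)).
  by have [le_xy _] := nat_Cauchy (f x) (f y); lia.
nia.
Qed.

(** For [h] the product or the quotient on [P x P], the cardinality of this set is the
    multiplicative energy of [P]. *)
Definition collisions (T U : choiceType) (A : {fset T}) (h : T -> U) : {fset T * T} :=
  [fset u in A `*` A | h u.1 == h u.2].

Lemma card_collisions (T U : choiceType) (A : {fset T}) (h : T -> U) :
  #|` collisions A h| = \sum_(y <- [fset h x | x in A]) #|` [fset x in A | h x == y]| ^ 2.
Proof.
rewrite (sum_card_fibers _ (fun u => h u.1)).
rewrite (_ : [fset _ | _ in collisions A h] = [fset h x | x in A]); last first.
  apply/fsetP => y; apply/imfsetP/imfsetP => -[] /=.
    by move=> u; rewrite !inE /= => /andP[/andP[uA _] _] ->; exists u.1.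
  by move=> x xA ->; exists (x, x); rewrite // !inE /= xA eqxx.
apply: eq_bigr => y _; rewrite expnS expn1 -card_fsetM.
congr #|` _|; apply/fsetP => -[x x']; rewrite !inE /=.
by case: (h x =P y) => [->|_]; rewrite ?andbF // eq_sym !andbT; case: (x \in A).
Qed.

Lemma card_sqr_le_collisions (T U : choiceType) (A : {fset T}) (h : T -> U) :
  #|` A| ^ 2 <= #|` [fset h x | x in A]| * #|` collisions A h|.
Proof.
by rewrite card_collisions [in leqLHS](sum_card_fibers _ h) sum_sqr_le.
Qed.

Section Solymosi.
Context {R : realFieldType}.
Implicit Types (P Z : {fset R}).
Local Open Scope ring_scope.

(* The number of points of [P x P] on the line of slope [mu]. *)
Definition slope_count P (mu : R) : nat := #|` [fset p in P | p * mu \in P]|.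

(* Sums of points on two consecutive rich lines lie strictly between these lines, so the
   sums obtained from different consecutive pairs are distinct. *)
Lemma card_rich_slopes P Z t : {in P, forall x, 0 < x} -> (0 < t)%N ->
    {in Z, forall mu, (t <= slope_count P mu)%N} ->
  (t ^ 2 * #|` Z| <= 2 * #|` sumset P P| ^ 2)%N.
Proof.
move=> Ppos t_gt0 Zrich; set S := #|` sumset P P|.
have [->|/fset0Pn[mu0 mu0Z]] := eqVneq Z fset0; first by rewrite cardfs0 muln0.
(* This pays for the largest slope of [Z], which has no successor, and causes the factor 2 in the
   conclusion. *)
have le_tS : (t <= S)%N.
  rewrite (leq_trans (Zrich _ mu0Z)) // (@leq_trans #|` P|) //.
    by apply/fsubset_leq_card/fsubsetP => x; rewrite !inE => /andP[].
  apply: (@leq_card_inj _ _ _ _ (fun x => x + x)) => [x y _ _|x xP].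
    by rewrite -!mulr2n => /eqP; rewrite -subr_eq0 -mulrnBl mulrn_eq0 /= subr_eq0 => /eqP.
  exact: mem_sumset.
pose Z' := [fset mu in Z | mu < next_in Z mu].
have cardZ : (#|` Z| <= #|` Z'|.+1)%N := card_lt_next_in Z.
suff leS : (t ^ 2 * #|` Z'| <= S ^ 2)%N.
  have : (t ^ 2 <= S ^ 2)%N by rewrite leq_exp2r.
  by move: leS; move: (t ^ 2)%N (S ^ 2)%N => a b; nia.
have -> : (S ^ 2 = #|` sumset P P `*` sumset P P|)%N by rewrite card_fsetM.
pose T := [fset u in Z' `*` (P `*` P) |
            (u.2.1 * u.1 \in P) && (u.2.2 * next_in Z u.1 \in P)].
apply: (@leq_trans #|` T|).
  apply: (@leq_card_fibers _ _ _ _ fst) => mu muZ'.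
  have := muZ'; rewrite !inE /= => /andP[muZ mu_lt].
  have nuZ := next_in_mem muZ.
  apply: (@leq_trans (slope_count P mu * slope_count P (next_in Z mu))).
    by rewrite expnS expn1 leq_mul ?Zrich.
  rewrite -card_fsetM; apply: (@leq_card_inj _ _ _ _ (fun v => (mu, v))) => [v w _ _ []//|].
  move=> [p q]; rewrite !inE /= => /andP[/andP[-> ->] /andP[-> ->]].
  by rewrite muZ mu_lt eqxx.
pose nu := next_in Z.
(* The image is the sum of the points of abscissae [u.2.1] and [u.2.2] on the lines of slopes [u.1]
   and [nu u.1]. *)
apply: (@leq_card_inj _ _ _ _ (fun u => (u.2.1 + u.2.2, u.2.1 * u.1 + u.2.2 * nu u.1))).
  have TP mu p q : (mu, (p, q)) \in T -> [/\ mu \in Z, mu < nu mu, 0 < p & 0 < q].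
    by rewrite !inE /= => /andP[/andP[/andP[-> ->] /andP[/Ppos -> /Ppos ->]]].
  have ltT mu p q mu' p' q' : (mu, (p, q)) \in T -> (mu', (p', q')) \in T ->
      mu < mu' -> p + q = p' + q' -> p * mu + q * nu mu < p' * mu' + q' * nu mu'.
    move=> /TP[muZ lt_mu p0 q0] /TP[mu'Z lt_mu' p'0 q'0] lt eqs.
    have [_ _ le_nu] := next_inP mu'Z lt; rewrite -/(nu mu) in le_nu.
    have : p * mu + q * nu mu < (p + q) * nu mu by nra.
    have : (p + q) * nu mu <= (p + q) * mu' by rewrite ler_wpM2l // ltW // addr_gt0.
    have : (p' + q') * mu' < p' * mu' + q' * nu mu' by nra.
    rewrite -eqs; lra.
  move=> [mu [p q]] [mu' [p' q']] uT u'T /= [eqs eqt].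
  have eqmu : mu = mu'.
    case: (ltgtP mu mu') => // lt.
      by have := ltT _ _ _ _ _ _ uT u'T lt eqs; rewrite eqt ltxx.
    by have := ltT _ _ _ _ _ _ u'T uT lt (esym eqs); rewrite eqt ltxx.
  move: eqt; rewrite -{}eqmu => eqt.
  have [_ lt_mu _ _] := TP _ _ _ uT.
  (* With equal slopes the abscissae solve a 2 x 2 linear system of determinant [nu mu - mu], which
     is nonzero. *)
  have /eqP : (q - q') * (nu mu - mu) = 0.
    have -> : (q - q') * (nu mu - mu) =
      (p * mu + q * nu mu) - (p' * mu + q' * nu mu) - (p + q - (p' + q')) * mu by ring.
    by rewrite eqt eqs !subrr mul0r subr0.
  rewrite mulf_eq0 [_ - mu == 0]subr_eq0 (gt_eqF lt_mu) orbF subr_eq0 => /eqP eqq.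
  by move: eqs; rewrite eqq => /addIr ->.
move=> [mu [p q]]; rewrite !inE /= => /andP[/andP[_ /andP[pP qP]] /andP[pmP qmP]].
by rewrite !mem_sumset.
Qed.

Lemma sqr_le_sum_layers r m : (r <= m)%N ->
  (r ^ 2 <= \sum_(1 <= t < m.+1 | t <= r) 2 * t)%N.
Proof.
move=> le_rm.
rewrite (_ : (\sum_(_ <= _ < _ | _) _)%N = \sum_(1 <= t < r.+1) (2 * t))%N.
  elim: r {le_rm} => [//|r IHr]; rewrite big_nat_recr //=; nia.
by rewrite (@big_nat_widen _ _ _ _ r.+1 m.+1).
Qed.

(** Layer-cake summation: the square of each slope count is at most the sum of [2 t] over [t] up to
    that count, and at most [2 |P + P|^2 / t^2] slopes have count at least [t]. *)
Lemma energy_le P : {in P, forall x, 0 < x} ->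
  (#|` collisions (P `*` P) (fun u => u.1 / u.2)|)%:R <=
     4 * (#|` sumset P P|)%:R ^+ 2 * \sum_(1 <= t < (#|` P|).+1) t%:R^-1 :> R.
Proof.
move=> Ppos; set S := #|` sumset _ _|; set m := #|` P|.
rewrite card_collisions; set Y := [fset _ | _ in _].
have slopeP mu : (#|` [fset u in P `*` P | u.1 / u.2 == mu]| <= slope_count P mu)%N.
  have eqP1 (u : R * R) : u \in P `*` P -> u.1 / u.2 = mu -> u.1 = u.2 * mu.
    by rewrite inE => /andP[_ /Ppos/lt0r_neq0 u0] <-; rewrite mulrC divfK.
  apply: (@leq_card_inj _ _ _ _ snd) => [u v|u]; rewrite !inE /=.
    move=> /andP[uP /eqP/eqP1 eu] /andP[vP /eqP/eqP1 ev] e.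
    by rewrite [u]surjective_pairing [v]surjective_pairing eu ?ev ?e ?inE.
  move=> /andP[uP /eqP/eqP1 eu]; rewrite -eu ?inE //.
  by move/andP: uP => [-> ->].
have slope_le mu : (slope_count P mu <= m)%N.
  by apply/fsubset_leq_card/fsubsetP => x; rewrite !inE => /andP[].
pose Yt t := [fset mu in Y | (t <= slope_count P mu)%N].
have leE : (\sum_(mu <- Y) #|` [fset u in (P `*` P)%fset | u.1 / u.2 == mu]| ^ 2 <=
            \sum_(1 <= t < m.+1) 2 * t * #|` Yt t|)%N.
  apply: (@leq_trans (\sum_(mu <- Y) \sum_(1 <= t < m.+1 | t <= slope_count P mu) 2 * t)%N).
    apply: leq_sum => mu _.
    by apply: leq_trans (sqr_le_sum_layers (slope_le mu)); rewrite leq_exp2r.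
  rewrite (exchange_big_dep xpredT) //=; apply: leq_sum => t _.
  by rewrite card_fset_sep big_distrr /=; under [leqRHS]eq_bigr do rewrite muln1.
rewrite -(ler_nat R) in leE; apply: (le_trans leE).
rewrite natr_sum mulr_sumr big_nat [leRHS]big_nat; apply: ler_sum => t /andP[t_gt0 _].
rewrite ler_pdivlMr ?ltr0n //.
have Yt_rich : {in Yt t, forall mu, (t <= slope_count P mu)%N}.
  by move=> mu; rewrite !inE => /andP[].
have le2 := card_rich_slopes Ppos t_gt0 Yt_rich.
rewrite -natrM -natrX -natrM ler_nat -/S in le2 *.
have -> : (2 * t * #|` Yt t| * t = 2 * (t ^ 2 * #|` Yt t|))%N by rewrite -mulnn; nia.
by rewrite (leq_trans (leq_mul (leqnn 2) le2)) // mulnA.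
Qed.

Lemma solymosi P : {in P, forall x, 0 < x} ->
  ((#|` P|)%:R ^+ 4 <= (#|` prodset P P|)%:R *
     (4 * (#|` sumset P P|)%:R ^+ 2 * \sum_(1 <= t < (#|` P|).+1) t%:R^-1) :> R).
Proof.
move=> Ppos.
have := card_sqr_le_collisions (P `*` P) (fun u => u.1 * u.2).
have -> : [fset u.1 * u.2 | u in P `*` P] = prodset P P.
  apply/fsetP => x; apply/imfsetP/imfset2P => /= -[].
    by move=> u; rewrite inE => /andP[u1 u2] ->; exists u.1 => //; exists u.2.
  by move=> a aP [b bP ->]; exists (a, b); rewrite // inE aP.
move=> le1; apply: (@le_trans _ _ (#|` prodset P P| *
    #|` collisions (P `*` P) (fun u => u.1 / u.2)|)%N%:R); last first.
  by rewrite natrM ler_wpM2l // energy_le.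
rewrite -natrX ler_nat card_fsetM in le1 *.
rewrite (_ : (_ ^ 4 = (#|` P| * #|` P|) ^ 2)%N); last by rewrite mulnn -expnM.
rewrite (leq_trans le1) // leq_mul //.
(* The relation [a b = c d] is rewritten as [a / c = d / b], turning product collisions into
   quotient collisions. *)
apply: (@leq_card_inj _ _ _ _ (fun u => ((u.1.1, u.2.1), (u.2.2, u.1.2)))).
  by move=> [[a b] [c d]] [[a' b'] [c' d']] _ _ /= [-> -> -> ->].
move=> [[a b] [c d]]; rewrite !inE /= => /andP[/andP[/andP[aP bP] /andP[cP dP]] /eqP e].
rewrite aP bP cP dP /= eqr_div ?lt0r_neq0 ?Ppos // e mulrC eqxx //.
Qed.
End Solymosi.

(** * Growth of the triple product set *)

Section Combination.
Context {R : realType}.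
Implicit Types (A B P : {fset R}).
Local Open Scope ring_scope.

Lemma diffset_subset A A' B B' : A `<=` A' -> B `<=` B' -> diffset A B `<=` diffset A' B'.
Proof.
move=> /fsubsetP subA /fsubsetP subB; apply/fsubsetP => _ /diffsetP[a [b [aA bB ->]]].
by rewrite mem_diffset ?subA ?subB.
Qed.

Lemma sumset_subset A A' B B' : A `<=` A' -> B `<=` B' -> sumset A B `<=` sumset A' B'.
Proof.
move=> /fsubsetP subA /fsubsetP subB; apply/fsubsetP => _ /sumsetP[a [b [aA bB ->]]].
by rewrite mem_sumset ?subA ?subB.
Qed.

(** Write [W = |P + P - P|]. Popular gaps of [P] and then of [B] give, up to constants,
    [|P|^2 <= W |B|] and [|B|^2 <= W |B'|], so [|P|^4 <= W^3 |B'|]; the cube of this meets the bound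
    on [|B'|^3] from [ln_squeeze]. *)
Lemma iterated_ln_sums_large : exists K : nat, forall P, {in P, forall x, 0 < x} ->
  (#|` P| ^ 12 <= K * #|` diffset (sumset P P) P| ^ 9 *
     #|` diffset (nsumset 4 [fset ln x | x in P]) (nsumset 3 [fset ln x | x in P])|)%N.
Proof.
exists ((16 ^ 2 * 64) ^ 3 * 216)%N => P Ppos.
have [->|P_gt0] := posnP #|` P|; first by rewrite exp0n.
have [d d0 [B subB [Bd sepd leP]]] := exists_popular_gap P.
have [e e0 [B' subB' [B'e sepe leB]]] := exists_popular_gap B.
have BP := fsubsetP subB; have B'B := fsubsetP subB'.
have leQ : (#|` B'|.+1 ^ 3 <= 216 * #|` diffset (nsumset 4 [fset ln x | x in P])
                                      (nsumset 3 [fset ln x | x in P])|)%N.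
  apply: (ln_squeeze d0 e0) => // [b bB'|a b aB' bB'|a b aB' bB'].
  - by split; [apply/BP/B'B|apply/Bd/B'B|apply/BP/B'e|apply/Bd/B'e].
  - by apply: sepd; [apply: B'B|apply/BP/B'B].
  by apply: sepe => //; apply: B'B.
have W_gt0 : (0 < #|` diffset (sumset P P) P|)%N.
  move: P_gt0; rewrite !cardfs_gt0 => /fset0Pn[a aP]; apply/fset0Pn.
  by exists (a + a - a); rewrite mem_diffset ?mem_sumset.
have leW : (#|` diffset (sumset B B) B| <= #|` diffset (sumset P P) P|)%N.
  by apply/fsubset_leq_card/diffset_subset; rewrite ?sumset_subset.
move: leQ W_gt0 leP {leB}(leq_trans leB (leq_mul (leq_mul (leqnn 16) leW) (leqnn _))).
move: #|` diffset (nsumset _ _) _| #|` diffset _ P| #|` P| #|` B| #|` B'|.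
clear => q w n b b' leQ w_gt0 leP leB.
have le2 : (b.+1 ^ 2 <= 64 * (w * b'.+1))%N.
  move: leB; rewrite -!mulnn; case: b {leP} => [|b]; nia.
have le4 : (n ^ 4 <= (16 ^ 2 * 64) * (w ^ 3 * b'.+1))%N.
  have -> : (n ^ 4 = (n ^ 2) ^ 2)%N by rewrite -expnM.
  apply: leq_trans (_ : ((16 * w * b.+1) ^ 2 <= _)%N); first by rewrite leq_exp2r.
  have -> : ((16 * w * b.+1) ^ 2 = (16 ^ 2 * w ^ 2) * b.+1 ^ 2)%N by rewrite !expnMn.
  have -> : ((16 ^ 2 * 64) * (w ^ 3 * b'.+1) = (16 ^ 2 * w ^ 2) * (64 * (w * b'.+1)))%N.
    by move: (16 ^ 2)%N 64%N => c1 c2; ring.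
  by rewrite leq_mul.
have -> : (n ^ 12 = (n ^ 4) ^ 3)%N by rewrite -expnM.
apply: leq_trans (_ : ((16 ^ 2 * 64 * (w ^ 3 * b'.+1)) ^ 3 <= _)%N).
  by rewrite leq_exp2r.
move: (16 ^ 2 * 64)%N => c.
have -> : ((c * (w ^ 3 * b'.+1)) ^ 3 = c ^ 3 * w ^ 9 * b'.+1 ^ 3)%N.
  by rewrite (expnMn c) (expnMn (w ^ 3)) -expnM mulnA.
have -> : (c ^ 3 * 216 * w ^ 9 * q = c ^ 3 * w ^ 9 * (216 * q))%N.
  by move: (c ^ 3)%N (w ^ 9)%N 216%N => c1 c2 c3; ring.
by rewrite leq_mul.
Qed.

Lemma sumset_ln A B : {in A, forall x, 0 < x} -> {in B, forall x, 0 < x} ->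
  sumset [fset ln x | x in A] [fset ln x | x in B] = [fset ln x | x in prodset A B].
Proof.
move=> A0 B0; apply/fsetP => y; apply/sumsetP/imfsetP => /=.
  move=> [_ [_ [/imfsetP[/= a aA ->] /imfsetP[/= b bB ->] ->]]].
  by exists (a * b); [exact: in_imfset2 | rewrite lnM ?posrE ?(A0 a aA) ?(B0 b bB)].
move=> [_ /imfset2P[/= a aA [b bB ->]] ->]; exists (ln a), (ln b).
by rewrite !in_imfset // lnM ?posrE ?(A0 a aA) ?(B0 b bB).
Qed.

Lemma prodset_gt0 A B : {in A, forall x, 0 < x} -> {in B, forall x, 0 < x} ->
  {in prodset A B, forall x, 0 < x}.
Proof. by move=> A0 B0 _ /imfset2P[/= a aA [b bB ->]]; rewrite mulr_gt0 ?(A0 a aA) ?(B0 b bB). Qed.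

Lemma card_ln A : {in A, forall x, 0 < x} -> #|` [fset ln x | x in A]| = #|` A|.
Proof.
by move=> A0; apply: card_in_imfset => x y /A0 x0 /A0 y0 /= /ln_inj; apply; rewrite posrE.
Qed.

Lemma harmonic_le_ln m : (0 < m)%N -> \sum_(1 <= t < m.+1) t%:R^-1 <= 1 + ln m%:R :> R.
Proof.
elim: m => [//|[_ _|m IHm _]]; first by rewrite big_nat1 ln1 addr0 invr1.
rewrite big_nat_recr //=; have {}IHm := IHm isT.
set x : R := m.+2%:R; have x0 : 0 < x by rewrite ltr0n.
have m0 : 0 < m.+1%:R :> R by rewrite ltr0n.
have xE : m.+1%:R = x * (1 + - x^-1) :> R.
  by rewrite mulrDr mulr1 mulrN divff ?gt_eqF // /x -[m.+2]addn1 natrD addrK.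
have x1 : 0 < 1 + - x^-1 by rewrite -(pmulr_rgt0 _ x0) -xE.
(* The step from [m + 1] to [x = m + 2] raises the logarithm by [- ln (1 - 1 / x)], which is at
   least the new term [1 / x]. *)
have : ln (1 + - x^-1) <= - x^-1 by apply: le_ln1Dx; rewrite -subr_gt0 opprK addrC.
move: IHm; rewrite xE lnM ?posrE //; clearbody x; lra.
Qed.

(** With [S], [D], [T] the sizes of [P + P], [PP], [PPP] and [m = |P|], Plünnecke-Ruzsa gives
    [W <= S^3 / m^2] and, for sums of logarithms, [Q <= T^7 / D^6]. Hence [m^30 D^6] is at most
    about [S^27 T^7], and the sixth power of Solymosi's bound eliminates [D]. *)
Lemma card_prodset3_bound : exists2 K : R, 0 < K & forall P, (0 < #|` P|)%N ->
    {in P, forall x, 0 < x} ->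
  (#|` P|)%:R ^+ 54 <= K * (#|` prodset3 P P P|)%:R ^+ 7 * (#|` sumset P P|)%:R ^+ 39
                       * (1 + ln (#|` P|)%:R) ^+ 6 :> R.
Proof.
have [K KP] := iterated_ln_sums_large.
exists (K.+1%:R * 4 ^+ 6) => [|P P_gt0 Ppos]; first by rewrite mulr_gt0 ?ltr0n ?exprn_gt0.
have PPpos := prodset_gt0 Ppos Ppos.
have leQ := KP P Ppos.
have leW := plunnecke_ruzsa P 2 1 P_gt0.
have leD := solymosi Ppos.
have leH := harmonic_le_ln P_gt0.
set L := [fset ln x | x in P] in leQ.
have PP_gt0 : (0 < #|` prodset P P|)%N.
  move: P_gt0; rewrite !cardfs_gt0 => /fset0Pn[a aP]; apply/fset0Pn.
  by exists (a * a); exact: in_imfset2.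
(* The base set is [L + L], of size [D]; adding [L] to it gives the logarithms of [PPP], so the
   growth ratio is [T / D]. *)
have leT := @plunnecke_ruzsa _ L (sumset L L) 4 3.
rewrite !sumset_ln // !card_ln // -/(prodset3 P P P) in leT; last exact: prodset_gt0.
have {}leT := leT PP_gt0.
rewrite (_ : nsumset 2 P = sumset (nsumset 1 P) P) // nsumset1 in leW.
move: leQ leW leD leH leT P_gt0 PP_gt0.
move: #|` diffset (nsumset _ _) _| #|` diffset _ P| #|` sumset P P| #|` prodset3 P P P|.
move: #|` prodset P P| #|` P| => D m Q W S T leQ leW leD leH leT m_gt0 D_gt0.
set H := 1 + ln _.
have S0 := ler0n R S.
have le30 : (m ^ 30 * D ^ 6 <= K * S ^ 27 * T ^ 7)%N.
  have m9D_gt0 : (0 < m ^ 9 * D)%N by rewrite muln_gt0 expn_gt0 m_gt0.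
  rewrite -(leq_pmul2r m9D_gt0).
  apply: (@leq_trans (K * (W * m ^ 3) ^ 9 * (Q * D ^ 7))).
    have -> : (m ^ 30 * D ^ 6 * (m ^ 9 * D) = m ^ 12 * (m ^ 27 * D ^ 7))%N by ring.
    have -> : (K * (W * m ^ 3) ^ 9 * (Q * D ^ 7) = K * W ^ 9 * Q * (m ^ 27 * D ^ 7))%N by ring.
    by rewrite leq_mul.
  have -> : (K * S ^ 27 * T ^ 7 * (m ^ 9 * D) = K * (S ^ 3 * m) ^ 9 * (T ^ 7 * D))%N by ring.
  by rewrite leq_mul // leq_mul // leq_exp2r.
have D6_gt0 : 0 < D%:R ^+ 6 :> R by rewrite exprn_gt0 ?ltr0n.
rewrite -(ler_pM2r D6_gt0).
have le24 : m%:R ^+ 24 <= D%:R ^+ 6 * (4 * S%:R ^+ 2 * H) ^+ 6 :> R.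
  rewrite (_ : 24 = 4 * 6)%N // exprM -exprMn lerXn2r ?nnegrE ?exprn_ge0 //.
    rewrite mulr_ge0 // mulr_ge0 //; first by rewrite mulr_ge0 // exprn_ge0.
    by rewrite addr_ge0 // ln_ge0 // ler1n.
  rewrite (le_trans leD) // ler_wpM2l // ler_wpM2l //.
  by rewrite mulr_ge0 // exprn_ge0.
have le30R : m%:R ^+ 30 * D%:R ^+ 6 <= K.+1%:R * S%:R ^+ 27 * T%:R ^+ 7 :> R.
  rewrite -!natrX -!natrM ler_nat (leq_trans le30) // -!mulnA leq_mul //.
rewrite (_ : m%:R ^+ 54 * _ = (m%:R ^+ 30 * D%:R ^+ 6) * m%:R ^+ 24); last first.
  by rewrite (_ : 54 = 30 + 24)%N // exprD mulrAC.
apply: le_trans (ler_pM _ _ le30R le24) _; rewrite ?mulr_ge0 ?exprn_ge0 //.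
rewrite le_eqVlt; apply/orP; left; apply/eqP.
by move: (K.+1%:R : R) => k; ring.
Qed.

(** Drop 0 and keep the larger of the positive and negative parts, negating the latter. Negation
    carries [PPP] into [- AAA] because three is odd. The factor 3 absorbs the lost 0, as
    [|A| > 1]. *)
Lemma exists_positive_part A : (1 < #|` A|)%N -> exists P, [/\ {in P, forall x, 0 < x},
  (#|` P| <= #|` A| <= 3 * #|` P|)%N, (#|` sumset P P| <= #|` sumset A A|)%N
  & (#|` prodset3 P P P| <= #|` prodset3 A A A|)%N].
Proof.
move=> A_gt1.
pose A1 := [fset x in A | 0 < x]; pose A2 := [fset x in A | x < 0].
have cardA : (#|` A| <= #|` A1| + #|` A2| + 1)%N.
  apply: (@leq_trans #|` A1 `|` A2 `|` [fset 0]|).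
    apply/fsubset_leq_card/fsubsetP => x xA; rewrite !inE /= xA.
    by case: ltgtP.
  by rewrite (leq_trans (leq_card_fsetU _ _)) // cardfs1 leq_add2r leq_card_fsetU.
have [le21|le12] := leqP #|` A2| #|` A1|.
  have sub : {in A1, forall x, x \in A} by move=> x; rewrite !inE => /andP[].
  have /fsubsetP subA := sub.
  exists A1; split; [by move=> x; rewrite !inE => /andP[]| | |].
    by apply/andP; split; [exact: fsubset_leq_card | lia].
    by apply/fsubset_leq_card/sumset_subset.
  apply/fsubset_leq_card/fsubsetP => x /prodset3P[a [b [c [/sub aA /sub bA /sub cA ->]]]].
  by apply/prodset3P; exists a, b, c.
have cardN : #|` [fset - x | x in A2]| = #|` A2| by rewrite card_imfset //; exact: oppr_inj.
have sub : {in [fset - x | x in A2], forall x, - x \in A}.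
  by move=> _ /imfsetP[/= x + ->]; rewrite opprK !inE => /andP[].
exists [fset - x | x in A2]; split.
- by move=> _ /imfsetP[/= x + ->]; rewrite !inE oppr_gt0 => /andP[].
- rewrite cardN; apply/andP; split; last by lia.
  by apply/fsubset_leq_card/fsubsetP => x; rewrite !inE => /andP[].
- apply: (@leq_card_inj _ _ _ _ -%R) => [x y _ _ /oppr_inj//|].
  by move=> _ /sumsetP[a [b [/sub aA /sub bA ->]]]; rewrite opprD mem_sumset.
apply: (@leq_card_inj _ _ _ _ -%R) => [x y _ _ /oppr_inj//|].
move=> _ /prodset3P[a [b [c [/sub aA /sub bA /sub cA ->]]]].
by apply/prodset3P; exists (- a), (- b), (- c); rewrite mulrNN mulrN.
Qed.
End Combination.

Local Open Scope ring_scope.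

Theorem theorem1p1 (R : realType) :
  exists (c1 c2 : R) (N : nat),
    [/\ 0 < c1, 0 < c2 &
      forall A : {fset R}, (N <= #|` A|)%N ->
        (#|` sumset A A|)%:R <= (#|` A|)%:R `^ (1 + c1) ->
        (#|` A|)%:R `^ (2 + c2) <= (#|` prodset3 A A A|)%:R].
Proof.
have [K K0 KP] := @card_prodset3_bound R.
(* The powers of 9, 3 and 54 come from the bounds on [PPP], [P + P] and [1 + ln m], the leading 3
   from [n <= 3 m]. The threshold [N0] forces [K' < n ^ (1/53)]. *)
pose K' : R := 3 * (K * 9 ^+ 7 * 3 ^+ 39 * 54 ^+ 6).
have [N0 N0P] : exists N0 : nat, K' ^+ 53 < N0%:R.
  by exists (Num.truncn (K' ^+ 53)).+1; exact: truncnS_gt.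
(* With [q = n ^ (1/53)], the bound on [m^54] becomes a constant times
   [m^(2 * 7 + 39) q^(7 + 39 + 6)], that is [m^53 q^52]. The spare factor [m >= q^53 / 3] exceeds
   this once [q] is large. *)
exists 53^-1, 53^-1, (maxn 2 N0).
rewrite !invr_gt0 !ltr0n; split=> // A.
rewrite geq_max => /andP[A_gt1 leN leS].
set n : R := (#|` A|)%:R.
have n0 : 0 < n by rewrite ltr0n ltnW.
pose q := n `^ 53^-1.
have qn : q ^+ 53 = n.
  by rewrite -powR_mulrn ?powR_ge0 // -powRrM mulVf ?pnatr_eq0 // powRr1 // ltW.
have q0 : 0 < q by exact: powR_gt0.
have q1 : 1 <= q.
  by rewrite -(@ler_pXn2r _ 53) ?nnegrE ?(ltW q0) // expr1n qn ler1n ltnW.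
have n_neq0 : n != 0 by rewrite gt_eqF.
rewrite -/n powRD ?n_neq0 ?implybT // powRr1 ?(ltW n0) // -/q in leS.
rewrite powRD ?n_neq0 ?implybT // (powR_mulrn 2) ?(ltW n0) // -/q.
rewrite leNgt; apply/negP => ltT.
have [P [Ppos /andP[leP geP] leSP leTP]] := exists_positive_part A_gt1.
have P_gt0 : (0 < #|` P|)%N by lia.
have := KP P P_gt0 Ppos; set m : R := (#|` P|)%:R.
have m0 : 0 < m by rewrite ltr0n.
have le_nm : n <= 3 * m by rewrite -natrM ler_nat.
have le_S : (#|` sumset P P|)%:R <= 3 * m * q.
  apply: le_trans (_ : n * q <= _); last by rewrite ler_pM2r.
  by apply: le_trans leS; rewrite ler_nat.
have le_T : (#|` prodset3 P P P|)%:R <= 9 * m ^+ 2 * q.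
  apply: le_trans (_ : n ^+ 2 * q <= _).
    by apply: le_trans (ltW ltT); rewrite ler_nat.
  rewrite ler_pM2r // (_ : 9 * m ^+ 2 = (3 * m) ^+ 2); last by ring.
  by rewrite lerXn2r ?nnegrE ?mulr_ge0 // ltW.
(* Here [ln n = 53 ln q], [ln q < q] and [1 <= q]. *)
have le_H : 1 + ln m <= 54 * q.
  have : ln m <= ln n by rewrite ler_ln ?posrE // ler_nat.
  have : ln n = 53 * ln q by rewrite -qn lnXn // mulr_natl.
  have := ln_sublinear q0; lra.
have H0 : 0 <= 1 + ln m by rewrite addr_ge0 // ln_ge0 // ler1n.
apply/negP; rewrite -ltNge.
apply: le_lt_trans (_ : K * (9 * m ^+ 2 * q) ^+ 7 * (3 * m * q) ^+ 39 * (54 * q) ^+ 6 < _).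
  have pos : 0 <= 9 * m ^+ 2 * q by rewrite !mulr_ge0 ?exprn_ge0 // ltW.
  have pos' : 0 <= 3 * m * q by rewrite !mulr_ge0 // ltW.
  have pos'' : 0 <= 54 * q by rewrite mulr_ge0 // ltW.
  apply: ler_pM; rewrite ?mulr_ge0 ?exprn_ge0 ?(ltW K0) //; last by rewrite lerXn2r ?nnegrE.
  apply: ler_pM; rewrite ?mulr_ge0 ?exprn_ge0 ?(ltW K0) //; last by rewrite lerXn2r ?nnegrE.
  by rewrite ler_wpM2l ?(ltW K0) // lerXn2r ?nnegrE.
have K'0 : 0 <= K' by rewrite !mulr_ge0 ?exprn_ge0 // ltW.
have lt_q : K' < q.
  rewrite -(@ltr_pXn2r _ 53) ?nnegrE ?(ltW q0) ?qn //.
  by apply: (lt_le_trans N0P); rewrite ler_nat.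
have lt_m : 3 ^-1 * K' * q ^+ 52 < m.
  have three0 : 0 < 3 :> R by rewrite ltr0n.
  rewrite -(ltr_pM2l three0) -[3^-1 * K' * _]mulrA mulVKf ?gt_eqF //.
  apply: lt_le_trans le_nm; have -> : n = q * q ^+ 52 by rewrite -exprS qn.
  by rewrite ltr_pM2r ?exprn_gt0.
have -> : m ^+ 54 = m * m ^+ 53 by rewrite -exprS.
apply: le_lt_trans (_ : 3 ^-1 * K' * q ^+ 52 * m ^+ 53 < _).
  rewrite le_eqVlt /K' mulKf ?pnatr_eq0 //; apply/orP; left; apply/eqP.
  by clear; clearbody m q; ring.
by rewrite ltr_pM2r ?exprn_gt0.
Qed.
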